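(* Consider the Gaussian sequence model $y_i=f_i+n^{-1/2}z_i$, $i=1,\dots,n$, with $z_i$ i.i.d. $N(0,1)$. Let $Tf=\sum_{i=1}^n f_i$ and let $$\mathcal{F}=\{f\in\mathbb{R}^n:\ \mathrm{Card}(\{i:f_i\ne0\})\le k_n\}.$$ Suppose that $n\ge4$ and that the positive integer $k_n$ satisfies $k_n<n^{\varepsilon}$ with $\varepsilon<1/2$. Then $$\inf_{\hat T}\sup_{f\in\mathcal{F}}E_f(\hat T-Tf)^2\ \ge\ \frac1{121}\,\frac{k_n^2}{n}\,\ln\Big(\frac n{k_n^2}\Big).$$
   Context: The infimum is over all estimators $\hat T$, i.e. all measurable real-valued functions of $(y_1,\dots,y_n)$ (which may depend on $n$ and $k_n$); $E_f$ is expectation when the true mean vector is $f$. *)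

(* Defs.v *)
From HB Require Import structures.
From mathcomp Require Export all_boot all_order all_algebra.
From mathcomp Require Export all_classical all_reals all_analysis.

Set Implicit Arguments.
Unset Strict Implicit.
Unset Printing Implicit Defensive.

Import Order.TTheory GRing.Theory Num.Theory.

Local Open Scope classical_set_scope.
Local Open Scope ring_scope.

Definition mutually_independent d (T : measurableType d) (R : realType)
    (P : probability T R) (I : finType) (X : I -> {RV P >-> R}) : Prop :=
  forall (J : {set I}) (A : I -> set R),
    (forall i, i \in J -> measurable (A i)) ->
    P (\bigcap_(i in [set` J]) (X i @^-1` A i)) =
    (\prod_(i in J) P (X i @^-1` A i))%E.

(* The law of Z is compared with N(0,1) on measurable sets only: library
   measures are total set functions, with irrelevant values elsewhere. *)
Definition standard_normal d (T : measurableType d) (R : realType)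
    (P : probability T R) (Z : {RV P >-> R}) : Prop :=
  forall A : set R, measurable A -> distribution P Z A = normal_prob 0 1 A.

Definition iid_standard_normal d (T : measurableType d) (R : realType)
    (P : probability T R) (n : nat) (z : 'I_n -> {RV P >-> R}) : Prop :=
  mutually_independent z /\ forall i, standard_normal (z i).

Definition observation d (T : measurableType d) (R : realType)
    (P : probability T R) (n : nat) (z : 'I_n -> {RV P >-> R})
    (f : n.-tuple R) (w : T) : n.-tuple R :=
  [tuple tnth f i + n%:R `^ (- 2^-1) * z i w | i < n].

Definition sum_functional (R : realType) (n : nat) (f : n.-tuple R) : R :=
  \sum_(i < n) tnth f i.

Definition sparse_means (R : realType) (n k : nat) : set (n.-tuple R) :=
  [set f : n.-tuple R | (#|[set i : 'I_n | tnth f i != 0%R]%SET| <= k)%N].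

Definition estimators (R : realType) (n : nat) : set (n.-tuple R -> R) :=
  [set That | measurable_fun [set: n.-tuple R] That].

Definition risk d (T : measurableType d) (R : realType)
    (P : probability T R) (n : nat) (z : 'I_n -> {RV P >-> R})
    (That : n.-tuple R -> R) (f : n.-tuple R) : \bar R :=
  'E_P[fun w => (That (observation z f w) - sum_functional f) ^+ 2].

Definition minimax_risk d (T : measurableType d) (R : realType)
    (P : probability T R) (n : nat) (z : 'I_n -> {RV P >-> R})
    (F : set (n.-tuple R)) : \bar R :=
  ereal_inf [set ereal_sup [set risk z That f | f in F]
            | That in @estimators R n].

(* Main.v *)
(** The risk at [f = 0] and the average risk over a family of sparse spike
    vectors cannot both be small.  Cut [k * m] of the [n] coordinates, with
    [m = n %/ k], into [k] blocks of size [m] and put one spike of height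
    [rho / sqrt n], [rho ^+ 2 = ln (n / k ^ 2)], anywhere in each block: [Tf] is
    [k * rho / sqrt n] for all these [f].  By the Cameron-Martin formula the
    observations under [f] have a likelihood ratio with respect to those under
    [0], and the average [L] of these ratios satisfies
    [E L^2 = (1 + (n / k^2 - 1) / m) ^ k <= (1 + 2 / k) ^ k <= e ^ 2].  Since
    [E L] is [1], an estimator which is close to [0] in mean square under
    [f = 0] is far from [k * rho / sqrt n] under the mixture. *)

From HB Require Import structures.
Require Import Defs.
From mathcomp Require Import measurable_realfun ring lra.

Set Implicit Arguments.
Unset Strict Implicit.
Unset Printing Implicit Defensive.

Import Order.TTheory GRing.Theory Num.Theory.
Import numFieldNormedType.Exports.

Local Open Scope classical_set_scope.
Local Open Scope ring_scope.

(* The proofs [mp] and [p0] are arguments so that the measure structure can be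
   inferred. *)
Definition mdensity d (T : measurableType d) (R : realType)
    (mu : {measure set T -> \bar R}) (p : T -> R)
    (mp : measurable_fun [set: T] p) (p0 : forall x, 0 <= p x) :
    set T -> \bar R :=
  fun A => (\int[mu]_(x in A) (p x)%:E)%E.

(** * Measures given by a density and integration against them *)

Section mdensity.
Context d (T : measurableType d) (R : realType).
Variables (mu : {measure set T -> \bar R}) (p : T -> R).
Hypotheses (mp : measurable_fun [set: T] p) (p0 : forall x, 0 <= p x).

Local Notation nu := (mdensity mu mp p0).

Let mdensity0 : nu set0 = 0%E.
Proof. exact: integral_set0. Qed.

Let mdensity_ge0 A : (0 <= nu A)%E.
Proof. by apply: integral_ge0 => x _; rewrite lee_fin. Qed.

Let mdensity_sigma_additive : semi_sigma_additive nu.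
Proof.
move=> F mF tF mUF; rewrite /mdensity ge0_integral_bigcup//; last 2 first.
- by apply/measurable_funTS/measurable_EFinP.
- by move=> x _; rewrite lee_fin.
apply: is_cvg_ereal_nneg_natsum_cond => n _ _.
by apply: integral_ge0 => x _; rewrite lee_fin.
Qed.

HB.instance Definition _ := isMeasure.Build _ _ _ nu
  mdensity0 mdensity_ge0 mdensity_sigma_additive.

Import HBNNSimple.

Let integral_mdensity_nnsfun (f : {nnsfun T >-> R}) :
  (\int[nu]_x (f x)%:E = \int[mu]_x ((f x)%:E * (p x)%:E))%E.
Proof.
under [LHS]eq_integral do rewrite fimfunE -fsumEFin//.
rewrite ge0_integral_fsum//; last 2 first.
  - by move=> r; exact/measurable_EFinP/measurableT_comp.
  - by move=> r x _; rewrite EFinM nnfun_muleindic_ge0.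
under [RHS]eq_integral => x _.
  rewrite fimfunE -fsumEFin// ge0_mule_fsuml; last first.
    by move=> r; rewrite EFinM nnfun_muleindic_ge0.
  over.
rewrite [RHS]ge0_integral_fsum//; last 2 first.
  - move=> r; apply: emeasurable_funM; last exact/measurable_EFinP.
    exact/measurable_EFinP/measurableT_comp.
  - move=> r x _; apply: mule_ge0; last by rewrite lee_fin.
    by rewrite EFinM nnfun_muleindic_ge0.
apply: eq_fsbigr => r _.
have mA : measurable (f @^-1` [set r]) by exact: measurable_sfunP.
rewrite integralZl_indic_nnsfun// integral_indic// setIT.
(* A negative level has empty preimage, [f] being nonnegative; a nonnegative one may be pulled out
   of the integral. *)
have [r0|r0] := ltP r 0.
  rewrite preimage_nnfun0// measure0 mule0 integral0_eq// => x _.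
  by rewrite indic0 mulr0 mul0e.
under [RHS]eq_integral do rewrite EFinM -muleA.
rewrite ge0_integralZl_EFin//; last 2 first.
  - by move=> x _; rewrite mule_ge0 ?lee_fin.
  - by apply: emeasurable_funM; apply/measurable_EFinP.
congr (_ * _)%E; rewrite [LHS]/= /mdensity [LHS]integral_mkcond.
apply: eq_integral => x _.
by rewrite patchE indicE; case: ifPn; rewrite ?mul1e ?mul0e.
Qed.

(** Nonnegative simple functions are settled level by level; an increasing sequence of them and
    monotone convergence on both sides give the general case. *)
Lemma ge0_integral_mdensity (f : T -> \bar R) :
  measurable_fun [set: T] f -> (forall x, 0 <= f x)%E ->
  (\int[nu]_x f x = \int[mu]_x (f x * (p x)%:E))%E.
Proof.
move=> mf f0; pose f_ := nnsfun_approx measurableT mf.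
have cf x : (f_ n x)%:E @[n --> \oo] --> f x.
  by apply: cvg_nnsfun_approx => // ? _; exact: f0.
have ndf x : {homo (f_ ^~ x) : m n / (m <= n)%N >-> m <= n}.
  by move=> m n mn; exact/lefP/nd_nnsfun_approx.
transitivity (limn (fun n => \int[nu]_x (f_ n x)%:E)%E).
  rewrite -monotone_convergence//.
  - by apply: eq_integral => x _; apply/esym/cvg_lim.
  - by move=> n; exact/measurable_EFinP.
  - by move=> n x _; rewrite lee_fin.
  - by move=> x _ m n mn; rewrite lee_fin ndf.
under eq_fun do rewrite integral_mdensity_nnsfun.
rewrite -monotone_convergence//.
- apply: eq_integral => x _; apply/cvg_lim => //.
  exact: cvgeZr.
- by move=> n; apply: emeasurable_funM; apply/measurable_EFinP.
- by move=> n x _; rewrite mule_ge0 ?lee_fin.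
- by move=> x _ m n mn; rewrite lee_pmul ?lee_fin ?ndf.
Qed.

End mdensity.

(** Both sides are integrals of [f] against image measures that agree on measurable sets. The two
    source spaces may differ, which allows a random variable to be compared with a law on the
    line. *)
Lemma eq_ge0_integral_law d1 d2 d3 (X1 : measurableType d1)
    (X2 : measurableType d2) (Y : measurableType d3) (R : realType)
    (mu1 : {measure set X1 -> \bar R}) (mu2 : {measure set X2 -> \bar R})
    (phi1 : X1 -> Y) (phi2 : X2 -> Y) (f : Y -> \bar R) :
  measurable_fun [set: X1] phi1 -> measurable_fun [set: X2] phi2 ->
  (forall A, measurable A -> mu1 (phi1 @^-1` A) = mu2 (phi2 @^-1` A)) ->
  measurable_fun [set: Y] f -> (forall y, 0 <= f y)%E ->
  (\int[mu1]_x f (phi1 x) = \int[mu2]_x f (phi2 x))%E.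
Proof.
move=> mphi1 mphi2 mu12 mf f0.
rewrite -[LHS](@ge0_integral_pushforward _ _ _ _ _ _ mphi1 _ setT f)//.
rewrite -[RHS](@ge0_integral_pushforward _ _ _ _ _ _ mphi2 _ setT f)//.
by apply: eq_measure_integral => //= A mA _; exact: mu12.
Qed.

(** * Translations of Lebesgue measure and of the standard normal law *)

Section normal_shift.
Context {R : realType}.
Local Notation mu := (@lebesgue_measure R).
Implicit Types (a : R) (A : set R).

(** Lebesgue measure is determined by its values on half-open intervals, and a translation preserves
    their lengths. *)
Lemma lebesgue_measureD a A : measurable A ->
  pushforward mu (+%R a : _ -> measurableTypeR R) A = mu A.
Proof.
have ma : measurable_fun [set: measurableTypeR R]
    (+%R a : _ -> measurableTypeR R).
  exact: measurable_funD.
move=> mA; apply/esym/lebesgue_measure_unique => //= _ [[x y]] _ <-.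
rewrite /pushforward (_ : _ @^-1` _ = `]x - a, y - a]%classic); last first.
  by apply/seteqP; split=> t /=; rewrite !in_itv/= lerBrDl ltrBlDl.
by rewrite !lebesgue_measure_itv/= !lte_fin ltrD2r -!EFinB opprB addrA subrK.
Qed.

Lemma ge0_integral_shift a (f : R -> \bar R) :
  measurable_fun [set: R] f -> (forall x, 0 <= f x)%E ->
  (\int[mu]_x f x = \int[mu]_x f (a + x)%R)%E.
Proof.
move=> mf f0.
have ma : measurable_fun [set: measurableTypeR R]
    (+%R a : _ -> measurableTypeR R).
  exact: measurable_funD.
refine (@eq_ge0_integral_law _ _ _ _ _ _ _ mu mu idfun (+%R a) f _ ma _ mf f0).
  exact: measurable_id.
by move=> A mA; exact/esym/(lebesgue_measureD a mA).
Qed.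

(** The likelihood ratio of N(a, 1) with respect to N(0, 1). *)
Definition tilt a (x : R) : R := expR (a * x - a ^+ 2 / 2).

Lemma tilt_ge0 a x : 0 <= tilt a x. Proof. exact: expR_ge0. Qed.

Lemma measurable_tilt a : measurable_fun [set: R] (tilt a).
Proof. by apply: measurableT_comp => //; apply: measurable_funB. Qed.

Lemma normal_pdf_tilt a x :
  normal_pdf 0 1 (- a + x) = tilt a x * normal_pdf 0 1 x :> R.
Proof.
rewrite normal_pdfE// mulrCA; congr (_ * _).
rewrite /normal_fun -expRD; congr expR.
by rewrite !subr0 expr1n; field.
Qed.

Lemma ge0_integral_normal (f : R -> \bar R) :
  measurable_fun [set: R] f -> (forall x, 0 <= f x)%E ->
  (\int[normal_prob 0 1]_x f x =
   \int[mu]_x (f x * (normal_pdf 0 1 x)%:E))%E.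
Proof.
move=> mf f0.
exact: (ge0_integral_mdensity mu (measurable_normal_pdf 0 1)
  (normal_pdf_ge0 0 1)).
Qed.

(** The Cameron-Martin formula in dimension one: substituting [- a + x] turns the shifted set back
    into [A] and multiplies the normal density by the tilt. *)
Lemma normal_prob_shift a A : measurable A ->
  (normal_prob 0 1 (+%R a @^-1` A) =
   \int[normal_prob 0 1]_(x in A) (tilt a x)%:E)%E.
Proof.
move=> mA.
have mt : measurable_fun [set: R] (EFin \o tilt a).
  by apply/measurable_EFinP; exact: measurable_tilt.
have mN : measurable_fun [set: R] (EFin \o normal_pdf 0 1).
  by apply/measurable_EFinP; exact: measurable_normal_pdf.
rewrite [RHS]integral_mkcond ge0_integral_normal; last 2 first.
- by apply/(measurable_restrictT _ _).1 => //; exact: measurable_funTS.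
- by apply: erestrict_ge0 => x _; rewrite lee_fin tilt_ge0.
rewrite /normal_prob [LHS]integral_mkcond/= (@ge0_integral_shift (- a)).
- apply: eq_integral => x _; rewrite !patchE.
  rewrite (_ : (- a + x \in _) = (x \in A)); last first.
    by apply/idP/idP; rewrite !inE/= addrA subrr add0r.
  by case: ifPn => _; rewrite ?mul0e// -EFinM normal_pdf_tilt.
- apply/(measurable_restrictT _ _).1; last exact: measurable_funTS.
  by rewrite -[X in measurable X]setTI; exact: measurable_funD.
- by apply: erestrict_ge0 => x _; rewrite lee_fin normal_pdf_ge0.
Qed.

End normal_shift.

(** * Boxes generate the measurable sets of tuples and determine finite measures *)

Section tuple_boxes.
Context d (T : measurableType d) (n : nat).
Implicit Types A : 'I_n -> set T.

Definition box A : set (n.-tuple T) := [set x | forall i, A i (tnth x i)].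

Definition boxes : set (set (n.-tuple T)) :=
  [set box A | A in [set A | forall i, measurable (A i)]].

Lemma measurable_box A : (forall i, measurable (A i)) -> measurable (box A).
Proof.
move=> mA; rewrite (_ : box A =
    \bigcap_(i in [set: 'I_n]) (@tnth n T ^~ i @^-1` A i)).
  apply: fin_bigcap_measurable => [|i _]; first exact: finite_finset.
  by rewrite -[X in measurable X]setTI; exact: measurable_tnth.
by apply/seteqP; split=> [x xA i _|x xA i]; exact: xA.
Qed.

Lemma setI_closed_boxes : setI_closed boxes.
Proof.
move=> _ _ [A mA <-] [B mB <-]; exists (fun i => A i `&` B i).
  by move=> i; exact: measurableI.
by apply/seteqP; split=> [x AB|x [xA xB] i]; split=> // i; case: (AB i).
Qed.

Lemma boxesT : boxes setT.
Proof.
exists (fun=> setT); first by move=> i; exact: measurableT.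
by apply/seteqP; split.
Qed.

(** The sigma-algebra on tuples is generated by the coordinate maps, and a condition on one
    coordinate is a box whose other sides are full. *)
Lemma measurable_boxesE : @measurable _ (n.-tuple T) = <<s boxes >>.
Proof.
apply/seteqP; split; last first.
  apply: smallest_sub; first exact: sigma_algebra_measurable.
  by move=> _ [A mA <-]; exact: measurable_box.
apply: smallest_sub; first exact: smallest_sigma_algebra.
rewrite -bigcup_seq => _ [i _ [A mA <-]]; apply: sub_sigma_algebra.
exists (fun j => if j == i then A else setT).
  by move=> j; case: ifP.
rewrite setTI; apply/seteqP; split=> [x /(_ i)|x xA j]; first by rewrite eqxx.
by case: eqP => // ->.
Qed.

(** Uniqueness of measures on a generating family closed under intersection. The whole space is
    itself a box, so finite total mass replaces an exhausting sequence. *)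
Lemma eq_law_boxes (R : realType) d1 d2 (X1 : measurableType d1)
    (X2 : measurableType d2)
    (mu1 : {measure set X1 -> \bar R}) (mu2 : {measure set X2 -> \bar R})
    (phi1 : X1 -> n.-tuple T) (phi2 : X2 -> n.-tuple T) :
  measurable_fun [set: X1] phi1 -> measurable_fun [set: X2] phi2 ->
  (mu1 setT < +oo)%E ->
  (forall A, (forall i, measurable (A i)) ->
    mu1 (phi1 @^-1` box A) = mu2 (phi2 @^-1` box A)) ->
  forall B, measurable B -> mu1 (phi1 @^-1` B) = mu2 (phi2 @^-1` B).
Proof.
move=> mphi1 mphi2 mu1oo mu12 B mB.
rewrite -/(pushforward mu1 phi1 B) -/(pushforward mu2 phi2 B).
apply: (measure_unique boxes (fun=> setT)) => //.
- exact: measurable_boxesE.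
- exact: setI_closed_boxes.
- by move=> _; exact: boxesT.
- by rewrite bigcup_const.
- by move=> _ [A mA <-]; exact: mu12.
Qed.

End tuple_boxes.

(** * The Cameron-Martin formula for a vector of independent normal variables *)

Section cameron_martin.
Context d (Omega : measurableType d) (R : realType) (P : probability Omega R).
Variables (n : nat) (z : 'I_n -> {RV P >-> R}).
Hypothesis hz : iid_standard_normal z.

Definition noise (w : Omega) : n.-tuple R := [tuple z i w | i < n].

Definition translate (h : 'I_n -> R) (x : n.-tuple R) : n.-tuple R :=
  [tuple tnth x i + h i | i < n].

Definition likelihood (h : 'I_n -> R) (x : n.-tuple R) : R :=
  \prod_(i < n) tilt (h i) (tnth x i).

Lemma measurable_noise : measurable_fun [set: Omega] noise.
Proof.
apply/measurable_fun_tnthP => i; rewrite (_ : _ \o _ = z i)//.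
by apply/funext => w /=; rewrite tnth_mktuple.
Qed.

Lemma measurable_translate h : measurable_fun [set: n.-tuple R] (translate h).
Proof.
apply/measurable_fun_tnthP => i.
rewrite (_ : _ \o _ = (fun x : n.-tuple R => tnth x i + h i)); last first.
  by apply/funext => x /=; rewrite tnth_mktuple.
by apply: measurable_funD => //; exact: measurable_tnth.
Qed.

Lemma measurable_likelihood h : measurable_fun [set: n.-tuple R] (likelihood h).
Proof.
apply: measurable_prod => i _.
by apply: (measurableT_comp (measurable_tilt _)); exact: measurable_tnth.
Qed.

Lemma likelihood_ge0 h x : 0 <= likelihood h x.
Proof. by apply: prodr_ge0 => i _; exact: tilt_ge0. Qed.

Lemma prob_box (A : 'I_n -> set R) : (forall i, measurable (A i)) ->
  P (noise @^-1` box A) = (\prod_(i < n) normal_prob 0 1 (A i))%E.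
Proof.
move=> mA; have [ind nrm] := hz.
rewrite (_ : _ @^-1` _ = \bigcap_(i in [set` [set: 'I_n]%SET]) (z i @^-1` A i)).
  rewrite ind//; apply: eq_big => [i|i _]; first by rewrite inE.
  exact: nrm.
apply/seteqP; split=> [w wA i _|w wA i].
  by have := wA i; rewrite tnth_mktuple.
by rewrite tnth_mktuple; apply: wA; rewrite /= inE.
Qed.

Let prob_box_split (i : 'I_n) (A : 'I_n -> set R) (C : set R) :
  (forall j, measurable (A j)) -> measurable C ->
  P (noise @^-1` box (fun j => if j == i then C else A j)) =
  (normal_prob 0 1 C * \prod_(j < n | j != i) normal_prob 0 1 (A j))%E.
Proof.
move=> mA mC; rewrite prob_box; last by move=> j; case: ifP.
rewrite (bigD1 i)//= eqxx; congr (_ * _)%E.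
by apply: eq_bigr => j /negbTE ->.
Qed.

(** Shifting coordinate [i] moves only side [i] of the box, and [z i] is independent of the other
    sides. This reduces the claim to [normal_prob_shift]. *)
Let shift1_box (i : 'I_n) (a : R) (A : 'I_n -> set R) :
  (forall j, measurable (A j)) ->
  (P (noise @^-1`
     (translate (fun j => if j == i then a else 0%R) @^-1` box A)) =
   \int[P]_(w in noise @^-1` box A) (tilt a (z i w))%:E)%E.
Proof.
move=> mA.
have mpre : measurable (+%R a @^-1` A i).
  by rewrite -[X in measurable X]setTI; exact: measurable_funD.
(* The event that all coordinates other than [i] lie in the box; [c] is its probability. *)
pose B := noise @^-1` box (fun j => if j == i then setT else A j).
have mB : measurable B.
  rewrite -[B]setTI; apply: measurable_noise => //.
  by apply: measurable_box => j; case: ifP.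
pose c := (\prod_(j < n | j != i) normal_prob 0 1 (A j))%E.
have c0 : (0 <= c)%E by exact: prode_ge0.
rewrite (_ : noise @^-1` _ = noise @^-1` box (fun j =>
    if j == i then +%R a @^-1` A i else A j)); last first.
  apply/seteqP; split=> w /= wA j; have := wA j; rewrite !tnth_mktuple;
    by case: eqP => [->|_]; rewrite /= ?addr0// addrC.
rewrite prob_box_split// -/c normal_prob_shift//.
have indep (C : set R) : measurable C ->
    (P (B `&` z i @^-1` C) = normal_prob 0 1 C * c)%E.
  move=> mC; rewrite -prob_box_split//; congr (P _).
  apply/seteqP; split=> [w [wB wC] j|w wA]; rewrite /= ?tnth_mktuple.
    case: eqP => [->//|/eqP/negbTE ji].
    by have := wB j; rewrite tnth_mktuple ji.
  split=> [j|]; last by have := wA i; rewrite tnth_mktuple eqxx.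
  by have := wA j; case: eqP.
have cE : c = P B.
  have := indep _ measurableT.
  by rewrite preimage_setT setIT probability_setT mul1e.
have cfin : c \is a fin_num by rewrite cE fin_num_measure.
have mt : measurable_fun [set: R] (EFin \o tilt a).
  by apply/measurable_EFinP; exact: measurable_tilt.
pose f := (EFin \o tilt a) \_ (A i).
have mf : measurable_fun [set: R] f.
  by apply/(measurable_restrictT _ _).1 => //; exact: measurable_funTS.
have f0 x : (0 <= f x)%E.
  by apply: erestrict_ge0 => ? _; rewrite lee_fin tilt_ge0.
have mB1 : measurable_fun [set: Omega] (\1_B : Omega -> R).
  exact: measurable_indic.
have B10 w : (0 <= \1_B w :> R) by rewrite indicE.
have mz : measurable_fun [set: Omega] (z i) by [].
(* The normal law scaled by [c] is the law of [z i] under [P] restricted to [B], the restriction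
   being encoded by the density [\1_B]. *)
transitivity (\int[mscale (NngNum (fine_ge0 c0)) (normal_prob 0 1)]_x f x)%E.
  by rewrite ge0_integral_mscale//= fineK// muleC [in LHS]integral_mkcond.
transitivity (\int[mdensity P mB1 B10]_w f (z i w))%E.
  refine (@eq_ge0_integral_law _ _ _ _ _ _ _
    (mscale (NngNum (fine_ge0 c0)) (normal_prob 0 1)) (mdensity P mB1 B10)
    idfun _ _ (@measurable_id _ _ _) mz _ mf f0) => C mC.
  have mzC : measurable (z i @^-1` C) by rewrite -[_ @^-1` _]setTI; exact: mz.
  transitivity ((fine c)%:E * normal_prob 0 1 C)%E; first by [].
  by rewrite fineK// muleC -indep// -integral_indic.
rewrite ge0_integral_mdensity//; last exact: measurableT_comp.
rewrite [RHS]integral_mkcond; apply: eq_integral => w _.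
rewrite /f /= !patchE indicE.
have -> : (w \in noise @^-1` box A) = (z i w \in A i) && (w \in B).
  apply/idP/andP; rewrite !inE /B/=.
    move=> wA; split=> [|j]; first by have := wA i; rewrite tnth_mktuple.
    by have := wA j; case: eqP.
  move=> [ziA wB] j.
  by have := wB j; case: eqP => // -> _; rewrite tnth_mktuple.
by case: (_ \in A i); case: (w \in B); rewrite ?(mul0e, mule0, mule1).
Qed.

(** The right side is an integral against [P] reweighted by the tilt, so it suffices that the
    shifted noise under [P] and the noise under the reweighted measure have the same law, which
    boxes detect. *)
Let ge0_integral_translate1 (i : 'I_n) (a : R) (g : n.-tuple R -> \bar R) :
  measurable_fun [set: n.-tuple R] g -> (forall x, 0 <= g x)%E ->
  (\int[P]_w g (translate (fun j => if j == i then a else 0%R) (noise w)) =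
   \int[P]_w (g (noise w) * (tilt a (tnth (noise w) i))%:E))%E.
Proof.
move=> mg g0.
have mp : measurable_fun [set: Omega] (tilt a \o z i).
  by apply: (measurableT_comp (measurable_tilt _)).
have p0 w : 0 <= (tilt a \o z i) w by exact: tilt_ge0.
under [RHS]eq_integral do rewrite tnth_mktuple.
rewrite -(ge0_integral_mdensity _ mp p0 (f := g \o noise)); last 2 first.
- exact: (measurableT_comp mg measurable_noise).
- by move=> w; exact: g0.
have mh : measurable_fun [set: Omega]
    (translate (fun j => if j == i then a else 0%R) \o noise).
  exact: (measurableT_comp (measurable_translate _) measurable_noise).
apply: (eq_ge0_integral_law mh measurable_noise _ mg g0).
apply: (eq_law_boxes mh measurable_noise) => [|A mA].
  exact: (le_lt_trans (probability_le1 P measurableT) (ltry 1)).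
exact: shift1_box.
Qed.

(** Coordinates are shifted one at a time, by induction on the list [s] of those to be shifted. *)
Let ge0_integral_translate_seq (h : 'I_n -> R) (s : seq 'I_n)
    (g : n.-tuple R -> \bar R) :
  uniq s -> measurable_fun [set: n.-tuple R] g -> (forall x, 0 <= g x)%E ->
  (\int[P]_w g (translate (fun j => if j \in s then h j else 0%R) (noise w)) =
   \int[P]_w (g (noise w) *
     (\prod_(i <- s) tilt (h i) (tnth (noise w) i))%:E))%E.
Proof.
elim: s g => [|i s IH] g /= us mg g0.
  apply: eq_integral => w _; rewrite big_nil mule1; congr g.
  by apply: eq_from_tnth => j; rewrite tnth_mktuple addr0.
have [/negbTE is_ {}us] := andP us.
pose g1 x := g (translate (fun j => if j \in s then h j else 0) x).
have mg1 : measurable_fun [set: n.-tuple R] g1.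
  exact: (measurableT_comp mg (measurable_translate _)).
transitivity (\int[P]_w g1 (translate (fun j => if j == i then h i else 0%R)
    (noise w)))%E.
  apply: eq_integral => w _; congr g; apply: eq_from_tnth => j.
  rewrite !tnth_mktuple inE; case: eqP => [->|_] /=.
    by rewrite is_ addr0.
  by rewrite addr0.
rewrite ge0_integral_translate1// => [|x]; last exact: g0.
(* The tilt at [i] can be absorbed into the integrand because the shifts along [s] leave coordinate
   [i] fixed. *)
pose g2 x := (g x * (tilt (h i) (tnth x i))%:E)%E.
transitivity (\int[P]_w g2 (translate (fun j => if j \in s then h j else 0%R)
    (noise w)))%E.
  apply: eq_integral => w _; rewrite /g1 /g2; congr (_ * (tilt _ _)%:E)%E.
  by rewrite [in RHS]tnth_mktuple is_ addr0.
rewrite IH//.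
- by apply: eq_integral => w _; rewrite /g2 big_cons -muleA EFinM.
- apply: emeasurable_funM => //; apply/measurable_EFinP.
  by apply: (measurableT_comp (measurable_tilt _)); exact: measurable_tnth.
- by move=> x; rewrite mule_ge0 ?lee_fin ?tilt_ge0.
Qed.

Lemma ge0_integral_translate (h : 'I_n -> R) (g : n.-tuple R -> \bar R) :
  measurable_fun [set: n.-tuple R] g -> (forall x, 0 <= g x)%E ->
  (\int[P]_w g (translate h (noise w)) =
   \int[P]_w (g (noise w) * (likelihood h (noise w))%:E))%E.
Proof.
move=> mg g0.
rewrite -(ge0_integral_translate_seq h (index_enum_uniq _) mg g0).
by apply: eq_integral => w _; congr g; apply: eq_from_tnth => j;
  rewrite !tnth_mktuple mem_index_enum.
Qed.

Lemma integral_likelihood (h : 'I_n -> R) :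
  (\int[P]_w (likelihood h (noise w))%:E = 1)%E.
Proof.
have := @ge0_integral_translate h (cst 1%E) (measurable_cst _) (fun=> lee01).
under [X in _ = X -> _]eq_integral do rewrite /= mul1e.
move=> <-; rewrite integral_cst//= mul1e; exact: probability_setT.
Qed.

(* Shifting by [h] multiplies the likelihood of [h'] by [expR <h, h'>]. *)
Lemma integral_likelihoodM (h h' : 'I_n -> R) :
  (\int[P]_w (likelihood h (noise w) * likelihood h' (noise w))%:E =
   (expR (\sum_(i < n) h i * h' i))%:E)%E.
Proof.
under eq_integral do rewrite EFinM muleC.
rewrite -(@ge0_integral_translate h (EFin \o likelihood h'))//; last 2 first.
- by apply/measurable_EFinP; exact: measurable_likelihood.
- by move=> x; rewrite lee_fin likelihood_ge0.
transitivity (\int[P]_w ((expR (\sum_(i < n) h i * h' i))%:E *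
    (likelihood h' (noise w))%:E))%E.
  apply: eq_integral => w _; rewrite -EFinM; congr EFin.
  rewrite expR_sum /likelihood -big_split/=; apply: eq_bigr => i _.
  by rewrite !tnth_mktuple /tilt -expRD; congr expR; ring.
rewrite ge0_integralZl_EFin//.
- by rewrite integral_likelihood mule1.
- by move=> w _; rewrite lee_fin likelihood_ge0.
- apply/measurable_EFinP.
  exact: (measurableT_comp (measurable_likelihood _) measurable_noise).
Qed.

End cameron_martin.

(** * A risk bound from the second moment of a mixture likelihood ratio *)

Section bayes_bound.
Context d (Omega : measurableType d) (R : realType) (P : probability Omega R).

Lemma ge0_integral_sumZ (Phi : finType) (c : R) (F : Phi -> Omega -> R) :
  0 <= c -> (forall phi, measurable_fun [set: Omega] (F phi)) ->
  (forall phi w, 0 <= F phi w) ->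
  (\int[P]_w (\sum_phi c * F phi w)%:E =
   \sum_phi c%:E * \int[P]_w (F phi w)%:E)%E.
Proof.
move=> c0 mF F0.
under eq_integral do rewrite -sumEFin.
rewrite ge0_integral_sum//; last 2 first.
- by move=> phi; apply/measurable_EFinP; exact: measurable_funM.
- by move=> phi w _; rewrite lee_fin mulr_ge0.
apply: eq_bigr => phi _; under eq_integral do rewrite EFinM.
rewrite ge0_integralZl_EFin//; first by move=> w _; rewrite lee_fin.
exact/measurable_EFinP.
Qed.

Variables (n : nat) (z : 'I_n -> {RV P >-> R}).
Hypothesis hz : iid_standard_normal z.

Local Notation sigma := (n%:R `^ (- 2^-1) : R).

Definition scale (a : R) (x : n.-tuple R) : n.-tuple R :=
  [tuple a * tnth x i | i < n].

Lemma measurable_scale a : measurable_fun [set: n.-tuple R] (scale a).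
Proof.
apply/measurable_fun_tnthP => i.
rewrite (_ : _ \o _ = (fun x : n.-tuple R => a * tnth x i)); last first.
  by apply/funext => x /=; rewrite tnth_mktuple.
by apply: measurable_funM => //; exact: measurable_tnth.
Qed.

Lemma observation_scale (h : 'I_n -> R) w :
  observation z (scale sigma [tuple h i | i < n]) w =
  scale sigma (translate h (noise z w)).
Proof.
by apply: eq_from_tnth => i; rewrite !tnth_mktuple mulrDr addrC.
Qed.

(** All risks become integrals under the same noise, with the mean carried by the likelihood. Means
    are written in units of [sigma], so that the noise has unit variance. *)
Lemma risk_scale (That : n.-tuple R -> R) (h : 'I_n -> R) :
  measurable_fun [set: n.-tuple R] That ->
  risk z That (scale sigma [tuple h i | i < n]) =
  (\int[P]_w ((That (scale sigma (noise z w)) - sigma * \sum_i h i) ^+ 2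
     * likelihood h (noise z w))%:E)%E.
Proof.
move=> mT; rewrite /risk unlock.
pose g x := (((That (scale sigma x) - sigma * \sum_i h i) ^+ 2)%:E).
transitivity (\int[P]_w g (translate h (noise z w)))%E.
  apply: eq_integral => w _; rewrite observation_scale /g.
  congr ((_ - _) ^+ 2)%:E; rewrite /sum_functional mulr_sumr.
  by apply: eq_bigr => i _; rewrite !tnth_mktuple.
rewrite (ge0_integral_translate hz).
- by apply: eq_integral => w _; rewrite EFinM.
- apply/measurable_EFinP/measurable_funX/measurable_funB => //.
  exact: (measurableT_comp mT (measurable_scale _)).
- by move=> x; rewrite lee_fin sqr_ge0.
Qed.

(** The mean 0 is compared with the uniform mixture over [Phi]. The double sum, divided by the
    squared cardinality of [Phi], is the second moment of the mixture likelihood ratio, here at most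
    16. *)
Lemma average_risk_lower_bound (Phi : finType) (h : Phi -> 'I_n -> R) (s : R)
    (That : n.-tuple R -> R) (r : \bar R) :
  measurable_fun [set: n.-tuple R] That -> (0 < #|Phi|)%N ->
  (forall phi, \sum_i h phi i = s) ->
  \sum_phi \sum_psi expR (\sum_i h phi i * h psi i) <= 16 * #|Phi|%:R ^+ 2 ->
  (risk z That (scale sigma [tuple 0%R | i < n]) <= r)%E ->
  (forall phi, risk z That (scale sigma [tuple h phi i | i < n]) <= r)%E ->
  (((sigma * s) ^+ 2 / 66)%:E <= r)%E.
Proof.
move=> mT Phi0 hs chi2 r0 rh.
have r_ge0 : (0 <= r)%E.
  apply: le_trans r0; rewrite /risk; apply: expectation_ge0 => w.
  exact: sqr_ge0.
case: r r_ge0 r0 rh => [r| |//] _ r0 rh; last by rewrite leey.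
set theta := sigma * s.
pose X w := That (scale sigma (noise z w)).
have mX : measurable_fun [set: Omega] X.
  exact: (measurableT_comp mT (measurableT_comp (measurable_scale _)
    (measurable_noise z))).
pose W phi w := likelihood (h phi) (noise z w).
have mW phi : measurable_fun [set: Omega] (W phi).
  exact: (measurableT_comp (measurable_likelihood _) (measurable_noise z)).
have W0 phi w : 0 <= W phi w by exact: likelihood_ge0.
pose c : R := #|Phi|%:R^-1.
have c0 : 0 <= c by rewrite invr_ge0.
have Nc : #|Phi|%:R * c = 1 by rewrite divff// pnatr_eq0 -lt0n.
pose L w := \sum_phi c * W phi w.
have L0 w : 0 <= L w by apply: sumr_ge0 => phi _; rewrite mulr_ge0.
have mL : measurable_fun [set: Omega] L.
  by apply: measurable_sum => phi; exact: measurable_funM.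
have sumc : \sum_(phi : Phi) c = 1.
  by rewrite sumr_const -[LHS]mulr_natl.
have intL : (\int[P]_w (L w)%:E = 1)%E.
  rewrite /L ge0_integral_sumZ//.
  under eq_bigr do rewrite integral_likelihood// mule1.
  by rewrite sumEFin sumc.
have intX : (\int[P]_w (X w ^+ 2)%:E <= r%:E)%E.
  move: r0; rewrite risk_scale// big1 ?mulr0//.
  under eq_integral => w _.
    rewrite subr0 [likelihood _ _]big1 ?mulr1; last first.
      by move=> i _; rewrite /tilt mul0r expr0n/= mul0r subr0 expR0.
    over.
  by [].
(* All means of the family have the same target [theta], so this integral is the average of their
   risks. *)
have intLX : (\int[P]_w (L w * (X w - theta) ^+ 2)%:E <= r%:E)%E.
  under eq_integral => w _.
    rewrite mulr_suml; under eq_bigr do rewrite -mulrA.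
    over.
  rewrite ge0_integral_sumZ//; last 2 first.
  - move=> phi; apply: measurable_funM => //.
    by apply: measurable_funX; exact: measurable_funB.
  - by move=> phi w; rewrite mulr_ge0// sqr_ge0.
  rewrite -[r]mul1r -sumc mulr_suml -sumEFin; apply: lee_sum => phi _.
  rewrite EFinM lee_wpmul2l ?lee_fin//.
  have := rh phi; rewrite risk_scale// hs => rphi.
  by under eq_integral do rewrite mulrC.
(* Expanding the square gives one exponential of an inner product for each pair, and [chi2] bounds
   their sum. *)
have intL2 : (\int[P]_w (L w ^+ 2)%:E <= 16%:E)%E.
  under eq_integral => w _.
    rewrite expr2 big_distrlr/= pair_bigA/=.
    under eq_bigr do rewrite mulrACA.
    over.
  rewrite (@ge0_integral_sumZ _ (c * c)
    (fun p w => W p.1 w * W p.2 w)) ?mulr_ge0//; last 2 first.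
  - by move=> p; exact: measurable_funM.
  - by move=> p w; rewrite mulr_ge0.
  under eq_bigr do rewrite integral_likelihoodM//.
  rewrite -(pair_bigA _ (fun phi psi => (c * c)%:E *
    (expR (\sum_i h phi i * h psi i))%:E)%E)/=.
  under eq_bigr do under eq_bigr do rewrite -EFinM.
  under eq_bigr do rewrite sumEFin -mulr_sumr.
  rewrite sumEFin -mulr_sumr lee_fin.
  apply: le_trans (ler_wpM2l _ chi2) _; first by rewrite mulr_ge0.
  by rewrite mulrCA -expr2 -exprMn [c * _]mulrC Nc expr1n mulr1.
(* [M] weighs the risk at 0; it stays abstract so that [M ^+ 2] is never
   unfolded to a unary sum.  Integrating [key] gives
   [M * theta^2 <= M * r + (M^2 * r + 16 * theta^2)], which for [M = 32] is
   [theta^2 <= 66 * r]. *)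
have [M M0 M32] : exists2 M : R, 0 <= M & M = 32 by exists 32.
have key w : M * theta ^+ 2 * L w <= M * (L w * (X w - theta) ^+ 2) +
    (M ^+ 2 * X w ^+ 2 + theta ^+ 2 * L w ^+ 2).
  rewrite -subr_ge0 [leRHS](_ : _ = M * (L w * X w ^+ 2) +
    (M * X w - theta * L w) ^+ 2); last by ring.
  by rewrite addr_ge0 ?sqr_ge0// mulr_ge0// mulr_ge0 ?sqr_ge0.
have mX2 : measurable_fun [set: Omega] (fun w => X w ^+ 2).
  exact: measurable_funX.
have mL2 : measurable_fun [set: Omega] (fun w => L w ^+ 2).
  exact: measurable_funX.
have mLX : measurable_fun [set: Omega] (fun w => L w * (X w - theta) ^+ 2).
  by apply: measurable_funM => //; apply: measurable_funX; exact: measurable_funB.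
have LX0 w : 0 <= L w * (X w - theta) ^+ 2 by rewrite mulr_ge0 ?sqr_ge0.
have intZ (b : R) (F : Omega -> R) : 0 <= b -> measurable_fun [set: Omega] F ->
    (forall w, 0 <= F w) ->
    (\int[P]_w (b * F w)%:E = b%:E * \int[P]_w (F w)%:E)%E.
  move=> b0 mF F0; under eq_integral do rewrite EFinM.
  rewrite ge0_integralZl_EFin//; first by move=> w _; rewrite lee_fin.
  exact/measurable_EFinP.
have : (\int[P]_w (M * theta ^+ 2 * L w)%:E <=
    M%:E * r%:E + ((M ^+ 2)%:E * r%:E + (theta ^+ 2)%:E * 16%:E))%E.
  apply: (@le_trans _ _ (\int[P]_w ((M * (L w * (X w - theta) ^+ 2))%:E +
    ((M ^+ 2 * X w ^+ 2)%:E + (theta ^+ 2 * L w ^+ 2)%:E)))%E).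
    apply: ge0_le_integral => //.
    - by move=> w _; rewrite lee_fin mulr_ge0// mulr_ge0// sqr_ge0.
    - by apply/measurable_EFinP; exact: measurable_funM.
    - apply: emeasurable_funD; last apply: emeasurable_funD;
        by apply/measurable_EFinP; exact: measurable_funM.
    - by move=> w _; rewrite -!EFinD lee_fin.
  rewrite ge0_integralD//=; last 4 first.
  - by move=> w _; rewrite lee_fin mulr_ge0.
  - by apply/measurable_EFinP; exact: measurable_funM.
  - by move=> w _; rewrite adde_ge0 // lee_fin mulr_ge0 ?sqr_ge0.
  - by apply: emeasurable_funD; apply/measurable_EFinP; exact: measurable_funM.
  rewrite ge0_integralD//=; last 4 first.
  - by move=> w _; rewrite lee_fin mulr_ge0 ?sqr_ge0.
  - by apply/measurable_EFinP; exact: measurable_funM.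
  - by move=> w _; rewrite lee_fin mulr_ge0 ?sqr_ge0.
  - by apply/measurable_EFinP; exact: measurable_funM.
  rewrite !intZ ?sqr_ge0//; do ?by move=> w; rewrite sqr_ge0.
  by apply: leeD; [|apply: leeD]; rewrite lee_wpmul2l ?lee_fin ?sqr_ge0.
have Mt0 : 0 <= M * theta ^+ 2 by rewrite mulr_ge0 ?sqr_ge0.
rewrite (intZ _ L)// intL mule1 -!EFinM -!EFinD !lee_fin M32.
lra.
Qed.

End bayes_bound.

(** * Vectors with one spike per block and their inner products *)

Section spikes.
Context (R : realType) (k m n : nat).
Variables (e : 'I_k * 'I_m -> 'I_n) (rho : R).
Hypothesis inj_e : injective e.
Implicit Types phi psi : {ffun 'I_k -> 'I_m}.

(** [e (j, a)] is position [a] of block [j], and [phi] selects a position in each block. Summing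
    over blocks avoids having to find the block that contains [i]. *)
Definition spikes phi (i : 'I_n) : R :=
  \sum_(j < k) rho * (e (j, phi j) == i)%:R.

Lemma sum_spikes phi : \sum_i spikes phi i = k%:R * rho.
Proof.
rewrite exchange_big/= (eq_bigr (fun=> rho)) => [|j _].
  by rewrite sumr_const card_ord mulr_natl.
rewrite (bigD1 (e (j, phi j)))//= eqxx mulr1 big1 ?addr0// => i.
by rewrite eq_sym => /negbTE ->; rewrite mulr0.
Qed.

(** Injectivity of [e] keeps the blocks disjoint, so two spikes overlap only in the same block and
    at the same position. *)
Lemma spikes_dot phi psi :
  \sum_i spikes phi i * spikes psi i =
  \sum_(j < k) rho ^+ 2 *+ (phi j == psi j).
Proof.
under eq_bigr do rewrite big_distrlr/=.
rewrite exchange_big; apply: eq_bigr => j _.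
rewrite exchange_big/= (bigD1 j)//= [X in _ + X]big1 ?addr0 => [|j' j'j].
  rewrite (bigD1 (e (j, phi j)))//= eqxx mulr1 big1 ?addr0 => [|i].
    by rewrite (inj_eq inj_e) xpair_eqE eqxx/= eq_sym mulrA -expr2 mulr_natr.
  by rewrite eq_sym => /negbTE ->; rewrite mulr0 mul0r.
apply: big1 => i _; case: eqP => [<-|_]; last by rewrite mulr0 mul0r.
by rewrite (inj_eq inj_e) xpair_eqE (negbTE j'j)/= !mulr0.
Qed.

Lemma spikes_sparse a phi :
  sparse_means k (scale a [tuple spikes phi i | i < n]).
Proof.
rewrite /sparse_means/= -[leqRHS]card_ord.
apply: leq_trans (leq_imset_card (fun j => e (j, phi j)) _).
apply/subset_leq_card/fintype.subsetP => i; rewrite !inE !tnth_mktuple.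
apply: contra_neqT => /imsetP Ni; rewrite [spikes _ _]big1 ?mulr0// => j _.
by case: eqP => [ei|_]; rewrite ?mulr0//; case: Ni; exists j.
Qed.

(** For fixed [phi] the exponential factors over blocks, so the sum over [psi] is a product of sums
    over positions. In each block one position agrees with [phi] and contributes [expR (rho ^+ 2)];
    the other [m - 1] contribute 1. *)
Lemma sum_exp_spikes_dot : (0 < m)%N ->
  \sum_phi \sum_psi expR (\sum_i spikes phi i * spikes psi i) =
  (m%:R ^+ k) * (expR (rho ^+ 2) + m%:R - 1) ^+ k :> R.
Proof.
move=> m0.
pose F (a b : 'I_m) : R := if a == b then expR (rho ^+ 2) else 1.
have sumF a : \sum_b F a b = expR (rho ^+ 2) + m%:R - 1.
  rewrite (bigD1 a)//= {1}/F eqxx -addrA; congr (_ + _).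
  rewrite (eq_bigr (fun=> 1)) => [|b]; last first.
    by rewrite /F eq_sym => /negbTE ->.
  by rewrite sumr_const cardC1 card_ord -[in RHS](prednK m0) -natr1 addrK.
transitivity (\sum_(phi : {ffun 'I_k -> 'I_m})
    (expR (rho ^+ 2) + m%:R - 1) ^+ k : R).
  apply: eq_bigr => phi _.
  transitivity (\sum_(psi : {ffun 'I_k -> 'I_m}) \prod_j F (phi j) (psi j)).
    apply: eq_bigr => psi _; rewrite spikes_dot expR_sum.
    apply: eq_bigr => j _; rewrite /F; case: eqP => _; first by rewrite mulr1n.
    by rewrite mulr0n expR0.
  rewrite -(bigA_distr_bigA (fun j b => F (phi j) b)).
  under eq_bigr do rewrite sumF.
  by rewrite prodr_const card_ord.
by rewrite sumr_const card_ffun !card_ord -[LHS]mulr_natl natrX.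
Qed.

End spikes.

(** * Numerical estimates and the placement of the blocks *)

Lemma expR2_le16 (R : realType) : expR 2 <= 16 :> R.
Proof.
have h : expR 2^-1 <= 2 :> R.
  rewrite -[leRHS]invrK -[leLHS]invrK lef_pV2 ?posrE ?invr_gt0 ?expR_gt0//.
  (* Convexity at [- 1/2] gives [expR (- 1/2) >= 1/2]; inverting and taking fourth powers bounds
     [expR 2]. *)
  rewrite -expRN; apply: le_trans (expR_ge1Dx _); lra.
rewrite [X in expR X](_ : 2 = 2^-1 * 4%:R); last by lra.
rewrite expRM_natr (_ : 16 = 2 ^+ 4); last by ring.
by rewrite lerXn2r ?nnegrE ?expR_ge0.
Qed.

(** The last hypothesis says [q - 1 <= 2 * m / k], so the base is at most [(1 + 2 / k) * m], and
    [(1 + 2 / k) ^+ k <= expR 2 <= 16]. *)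
Lemma overlap_bound (R : realType) (k m : nat) (q : R) :
  (0 < k)%N -> 0 <= q + m%:R - 1 -> k%:R * q <= 2 * m%:R + k%:R ->
  (q + m%:R - 1) ^+ k <= 16 * m%:R ^+ k.
Proof.
move=> k0 q0 qm.
have kR : 0 < k%:R :> R by rewrite ltr0n.
apply: (@le_trans _ _ ((expR (2 / k%:R) * m%:R) ^+ k)); last first.
  rewrite exprMn ler_wpM2r ?exprn_ge0// -expRM_natr divfK ?gt_eqF//.
  exact: expR2_le16.
rewrite lerXn2r// ?nnegrE ?mulr_ge0 ?expR_ge0//.
apply: (@le_trans _ _ ((1 + 2 / k%:R) * m%:R)); last first.
  by rewrite ler_wpM2r// expR_ge1Dx.
rewrite -(ler_pM2l kR).
rewrite [leRHS](_ : _ = k%:R * m%:R + 2 * m%:R); last by field; rewrite gt_eqF.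
by rewrite mulrDr mulrDr mulrN1; lra.
Qed.

Lemma block_injection (k m n : nat) : (k * m <= n)%N ->
  exists e : 'I_k * 'I_m -> 'I_n, injective e.
Proof.
move=> kmn; have c : (#|{: 'I_k * 'I_m}| <= n)%N by rewrite card_prod !card_ord.
exists (fun p => widen_ord c (enum_rank p)) => p p' /(congr1 val) /= pp'.
exact/enum_rank_inj/val_inj.
Qed.

(** * Choice of the spikes and conclusion *)

Theorem theorem7 (R : realType) (d : measure_display) (Omega : measurableType d)
    (P : probability Omega R) (n k : nat) (eps : R)
    (z : 'I_n -> {RV P >-> R})
    (hz : iid_standard_normal z)
    (hn : (4 <= n)%N) (hk0 : (0 < k)%N)
    (heps : eps < 2^-1) (hk : k%:R < n%:R `^ eps :> R) :
  ((121^-1 * (k%:R ^+ 2 / n%:R) * ln (n%:R / k%:R ^+ 2))%:E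
     <= minimax_risk z (@sparse_means R n k))%E.
Proof.
have n0 : 0 < n%:R :> R by rewrite ltr0n (leq_trans _ hn).
have k0 : 0 < k%:R :> R by rewrite ltr0n.
have k2n : k%:R ^+ 2 < n%:R :> R.
  have : k%:R < n%:R `^ 2^-1 :> R.
    apply: lt_le_trans hk _; apply: ler_powR; last exact: ltW.
    by rewrite ler1n (leq_trans _ hn).
  rewrite -(@ltr_pXn2r _ 2) ?nnegrE ?powR_ge0 ?ler0n// => /lt_le_trans; apply.
  by rewrite -powR_mulrn ?powR_ge0// -powRrM mulVf// powRr1// ltW.
set q : R := n%:R / k%:R ^+ 2.
have q1 : 1 < q by rewrite ltr_pdivlMr ?mul1r// exprn_gt0.
have lnq : 0 <= ln q by rewrite ln_ge0// ltW.
(* This height makes [expR (rho ^+ 2)] equal to [q]; [lnq] keeps the square root away from its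
   default value 0 at negative arguments. *)
pose rho := Num.sqrt (ln q).
have rho2 : rho ^+ 2 = ln q by rewrite sqr_sqrtr.
pose m := (n %/ k)%N.
have kn : (k <= n)%N.
  have : (k ^ 2 < n)%N by rewrite -(ltr_nat R) natrX.
  by move=> /ltnW; apply: leq_trans; rewrite leq_pmulr.
have m0 : (0 < m)%N by rewrite divn_gt0.
have [e inj_e] : exists e : 'I_k * 'I_m -> 'I_n, injective e.
  by apply: block_injection; rewrite mulnC leq_trunc_div.
(* Rounding costs at most one unit: [n / k < m + 1], and [m + 1 <= 2 * m + k]. *)
have mq : k%:R * q <= 2 * m%:R + k%:R.
  have -> : k%:R * q = n%:R / k%:R.
    by rewrite /q; field; rewrite gt_eqF.
  rewrite ler_pdivrMr//; apply: (@le_trans _ _ ((m.+1 * k)%N%:R)).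
    by rewrite ler_nat ltnW// ltn_ceil.
  rewrite natrM ler_wpM2r ?ler0n// -natr1.
  have : 1 <= m%:R :> R by rewrite ler1n.
  have : 1 <= k%:R :> R by rewrite ler1n.
  lra.
apply: le_ereal_inf_tmp => _ [That mT <-].
have ler f : sparse_means k f ->
    (risk z That f <= ereal_sup [set risk z That f | f in sparse_means k])%E.
  by move=> kf; apply: ereal_sup_ubound; exists f.
(* The mixture bound has the constant 1/66, which exceeds the required 1/121. *)
apply: (@le_trans _ _ ((n%:R `^ (- 2^-1) * (k%:R * rho)) ^+ 2 / 66)%:E).
  have sigma2 : (n%:R `^ (- 2^-1)) ^+ 2 = n%:R^-1 :> R.
    by rewrite -powR_mulrn ?powR_ge0// -powRrM mulNr mulVf// powR_inv1// ltW.
  rewrite lee_fin !exprMn sigma2 rho2 -/q.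
  have u0 : 0 <= k%:R ^+ 2 / n%:R * ln q.
    by rewrite mulr_ge0// divr_ge0 ?exprn_ge0// ltW.
  rewrite -mulrA [leRHS](_ : _ = k%:R ^+ 2 / n%:R * ln q / 66); last by ring.
  lra.
(* The common bound [r] is the supremum of the risk over sparse means; it covers both the zero
   vector and every spike vector. *)
apply: (@average_risk_lower_bound _ _ _ _ _ z hz {ffun 'I_k -> 'I_m}
  (spikes e rho) (k%:R * rho) That _ mT).
- by rewrite card_ffun !card_ord expn_gt0 m0.
- exact: sum_spikes.
- rewrite sum_exp_spikes_dot// rho2 lnK ?posrE ?(lt_trans _ q1)//.
  rewrite card_ffun !card_ord natrX expr2 [leRHS]mulrCA ler_wpM2l ?exprn_ge0//.
  by apply: overlap_bound => //; have := ler0n R m; lra.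
- apply: ler; rewrite /sparse_means/=.
  rewrite (_ : [set _ | _]%SET = finset.set0) ?cards0//; apply/setP => i.
  by rewrite !inE !tnth_mktuple mulr0 eqxx.
- by move=> phi; apply: ler; exact: spikes_sparse.
Qed.
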